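(* For each step size $h>0$ define $\delta(h) = \sup_{i \ge 0} |x(ih) - x_i|$, where $x(\cdot)$ is the unique continuous $S$-valued solution on $[0,\infty)$ of the integral equation $$x(t) = x_0(t) + \int_0^t e^{\alpha_1 s - \alpha_2 t} f(t,s,x(s))\,ds + \int_t^\infty e^{-\beta s + \gamma t} g(t,s,x(s))\,ds,$$ and $\{x_i : i = 1,2,\ldots\}$ (depending on $h$) is the unique $S$-valued sequence solving the discretized equation $$x_i = x_0(ih) + \sum_{j=0}^{i-1} \left( \int_{jh}^{(j+1)h} e^{\alpha_1 s - \alpha_2 ih}\,ds \right) f(ih, jh, x_j) + \sum_{j=i}^{\infty} \left( \int_{jh}^{(j+1)h} e^{-\beta s + \gamma ih}\,ds \right) g(ih, jh, x_j), \quad i = 1,2,\ldots,$$ where the value at the node $i=0$ is taken to be exact, i.e. the vector $x_j$ with $j=0$ is $x(0)$, so that the $i=0$ term $|x(0)-x_i|_{i=0}$ in the supremum is $0$. Then $\delta(h) = O(h)$ as $h \to 0^+$.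
   Context: Fix a norm $|\cdot|$ on $\mathbb{R}^n$. The real constants $\alpha_1,\alpha_2,\beta,\gamma$ satisfy $\alpha_1 \ne 0$, $\alpha_2 \ge 0$, $\alpha_1 \le \alpha_2$, $\beta > 0$, $\beta \ge \gamma$. The data are a function $x_0(\cdot):[0,\infty)\to\mathbb{R}^n$ (written with its argument, to distinguish it from the discrete value at node $0$) and $\mathbb{R}^n$-valued functions $f(t,s,x)$, defined for $0\le s\le t<\infty$, $x\in S$, and $g(t,s,x)$, defined for $0\le t\le s<\infty$, $x\in S$. Standing assumptions: (i) $f$ and $g$ are Lipschitz in $x\in S$ uniformly in $(t,s)$ in their respective domains, with Lipschitz constants $L_f$, $L_g$ satisfying $\frac{L_f}{|\alpha_1|} + \frac{L_g}{\beta} < 1$. (ii) $f$ and $g$ are continuous in all their arguments on their respective domains, and $|f|\le C_f$, $|g|\le C_g$ there, for constants $C_f,C_g$. (iii) $S = \{x\in\mathbb{R}^n : |x| \le \|x_0\|_\infty + \frac{C_f}{|\alpha_1|} + \frac{C_g}{\beta}\}$, where $\|x_0\|_\infty=\sup_{t\ge 0}|x_0(t)|$. (iv) $f$ and $g$ are continuously differentiable in $s$ and $t$ on their respective domains, with bounded derivatives: $|\partial_t f|\le D_f$, $|\partial_s f|\le E_f$, $|\partial_t g|\le D_g$, $|\partial_s g|\le E_g$, for constants $D_f,E_f,D_g,E_g$. (v) $x_0(\cdot)$ is bounded and differentiable with bounded derivative on $[0,\infty)$. Under these assumptions, the integral equation has a unique solution among continuous functions $[0,\infty)\to S$, and for each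 $h>0$ the discretized equation has a unique solution among sequences with values in $S$. *)

(* Defs.v *)
From HB Require Import structures.
From mathcomp Require Import all_boot all_order all_algebra.
From mathcomp Require Import all_classical all_reals all_analysis.

Set Implicit Arguments.
Unset Strict Implicit.
Unset Printing Implicit Defensive.

Import Order.TTheory GRing.Theory Num.Theory.
Import numFieldNormedType.Exports.

Local Open Scope classical_set_scope.
Local Open Scope ring_scope.

(* R^n is 'rV[R]_n with its library topology; the norm of the problem is an
   arbitrary function N satisfying is_norm, unrelated to the canonical sup norm
   of 'rV[R]_n. Nonnegativity of N is a consequence of the axioms. *)
Record is_norm (R : realType) (n : nat) (N : 'rV[R]_n -> R) : Prop := IsNorm {
  is_norm_triangle : forall x y, N (x + y) <= N x + N y ;
  is_norm_homo : forall (a : R) x, N (a *: x) = `|a| * N x ;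
  is_norm_eq0 : forall x, N x = 0 -> x = 0
}.

Definition half_line (R : realType) : set R := `[0, +oo[.
Arguments half_line : clear implicits.

(* Domains of f(t, s, .) and g(t, s, .); the pair is always (t, s). *)
Definition dom_f (R : realType) : set (R * R) := [set p | 0 <= p.2 <= p.1].
Definition dom_g (R : realType) : set (R * R) := [set p | 0 <= p.1 <= p.2].
Arguments dom_f : clear implicits.
Arguments dom_g : clear implicits.

Definition sup_norm (R : realType) (n : nat) (N : 'rV[R]_n -> R)
    (x0 : R -> 'rV[R]_n) : R :=
  sup [set N (x0 t) | t in half_line R].

Definition state_set (R : realType) (n : nat) (N : 'rV[R]_n -> R)
    (x0 : R -> 'rV[R]_n) (a1 b Cf Cg : R) : set 'rV[R]_n :=
  [set x | N x <= sup_norm N x0 + Cf / `|a1| + Cg / b].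

(* phi has derivative d at t relative to A: one-sided at an endpoint of an
   interval A. If t is an isolated point of A the condition is void. *)
Definition is_derive_within (R : realType) (n : nat) (A : set R)
    (phi : R -> 'rV[R]_n) (t : R) (d : 'rV[R]_n) : Prop :=
  (fun u => (u - t)^-1 *: (phi u - phi t)) @ within A t^' --> d.

Definition unif_lipschitz (R : realType) (n : nat) (N : 'rV[R]_n -> R)
    (D : set (R * R)) (S : set 'rV[R]_n)
    (F : R -> R -> 'rV[R]_n -> 'rV[R]_n) (L : R) : Prop :=
  forall t s x y, D (t, s) -> S x -> S y ->
    N (F t s x - F t s y) <= L * N (x - y).

Definition unif_bounded (R : realType) (n : nat) (N : 'rV[R]_n -> R)
    (D : set (R * R)) (S : set 'rV[R]_n)
    (F : R -> R -> 'rV[R]_n -> 'rV[R]_n) (C : R) : Prop :=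
  forall t s x, D (t, s) -> S x -> N (F t s x) <= C.

Definition jointly_continuous (R : realType) (n : nat)
    (D : set (R * R)) (S : set 'rV[R]_n)
    (F : R -> R -> 'rV[R]_n -> 'rV[R]_n) : Prop :=
  {within D `*` S, continuous (fun p : R * R * 'rV[R]_n => F p.1.1 p.1.2 p.2)}.

(* F(t, s, x) is C^1 in (t, s) on D for each fixed x in S, and its partial
   derivatives Ft, Fs are bounded by Mt, Ms on D x S. At the corner (0, 0) one
   of the two slices of D is a single point; the corresponding partial
   derivative is then determined by continuity. *)
Definition C1_bounded (R : realType) (n : nat) (N : 'rV[R]_n -> R)
    (D : set (R * R)) (S : set 'rV[R]_n)
    (F : R -> R -> 'rV[R]_n -> 'rV[R]_n) (Mt Ms : R) : Prop :=
  exists Ft Fs : R -> R -> 'rV[R]_n -> 'rV[R]_n,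
    (forall t s x, D (t, s) -> S x ->
       is_derive_within [set u | D (u, s)] (fun u => F u s x) t (Ft t s x) /\
       is_derive_within [set u | D (t, u)] (fun u => F t u x) s (Fs t s x)) /\
    (forall x, S x ->
       {within D, continuous (fun p : R * R => Ft p.1 p.2 x)} /\
       {within D, continuous (fun p : R * R => Fs p.1 p.2 x)}) /\
    unif_bounded N D S Ft Mt /\
    unif_bounded N D S Fs Ms.

Definition C1_bounded_path (R : realType) (n : nat) (N : 'rV[R]_n -> R)
    (x0 : R -> 'rV[R]_n) : Prop :=
  (exists M, forall t, half_line R t -> N (x0 t) <= M) /\
  (exists dx0 : R -> 'rV[R]_n,
     (forall t, half_line R t ->
        is_derive_within (half_line R) x0 t (dx0 t)) /\
     (exists M, forall t, half_line R t -> N (dx0 t) <= M)).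

(* Componentwise integral. The real-valued Lebesgue integral is total; on the
   bounded continuous integrands with exponential weights below it is the usual
   (improper, on [t, +oo[) integral. *)
Definition vintegral (R : realType) (n : nat) (A : set R)
    (F : R -> 'rV[R]_n) : 'rV[R]_n :=
  \row_(k < n) \int[lebesgue_measure]_(s in A) F s 0 k.

Definition integral_solution (R : realType) (n : nat) (S : set 'rV[R]_n)
    (a1 a2 b c : R) (x0 : R -> 'rV[R]_n)
    (f g : R -> R -> 'rV[R]_n -> 'rV[R]_n) (x : R -> 'rV[R]_n) : Prop :=
  {within half_line R, continuous x} /\
  (forall t, half_line R t -> S (x t)) /\
  (forall t, half_line R t ->
     x t = x0 t
       + vintegral `[0, t] (fun s => expR (a1 * s - a2 * t) *: f t s (x s))
       + vintegral `[t, +oo[ (fun s => expR (- b * s + c * t) *: g t s (x s))).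

Definition cell (R : realType) (h : R) (j : nat) : set R :=
  `[j%:R * h, j.+1%:R * h].

Definition weight_f (R : realType) (a1 a2 h : R) (i j : nat) : R :=
  \int[lebesgue_measure]_(s in cell h j) expR (a1 * s - a2 * (i%:R * h)).

Definition weight_g (R : realType) (b c h : R) (i j : nat) : R :=
  \int[lebesgue_measure]_(s in cell h j) expR (- b * s + c * (i%:R * h)).

(* xstart is the prescribed value at node 0; the equation is imposed only at
   the nodes i >= 1. With b > 0 and g bounded on S the weights are summable in
   j, so the limit of partial sums exists and limn is never a default value. *)
Definition discrete_solution (R : realType) (n : nat) (S : set 'rV[R]_n)
    (a1 a2 b c : R) (x0 : R -> 'rV[R]_n)
    (f g : R -> R -> 'rV[R]_n -> 'rV[R]_n)
    (h : R) (xstart : 'rV[R]_n) (y : nat -> 'rV[R]_n) : Prop :=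
  y 0%N = xstart /\
  (forall i, S (y i)) /\
  (forall i : nat, (1 <= i)%N ->
     y i = x0 (i%:R * h)
       + \sum_(0 <= j < i)
           weight_f a1 a2 h i j *: f (i%:R * h) (j%:R * h) (y j)
       + limn (fun m => \sum_(i <= j < m)
           weight_g b c h i j *: g (i%:R * h) (j%:R * h) (y j))).

(* The set is bounded as soon as x and y are S-valued, so sup is the true
   supremum. *)
Definition disc_error (R : realType) (n : nat) (N : 'rV[R]_n -> R)
    (x : R -> 'rV[R]_n) (y : R -> nat -> 'rV[R]_n) (h : R) : R :=
  sup [set N (x (i%:R * h) - y h i) | i in [set: nat]].

(* Main.v *)
Require Import Defs.
From HB Require Import structures.
From mathcomp Require Import all_boot all_order all_algebra.
From mathcomp Require Import ring lra.
From mathcomp Require Import all_classical all_reals all_analysis.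
From mathcomp Require Import measurable_realfun.

Set Implicit Arguments.
Unset Strict Implicit.
Unset Printing Implicit Defensive.

Import Order.TTheory GRing.Theory Num.Theory.
Import numFieldNormedType.Exports.

Local Open Scope classical_set_scope.
Local Open Scope ring_scope.

(** The solution [x] is Lipschitz, and the discretized equation is obtained from
    the integral equation by freezing [f(ih, s, x(s))] and [g(ih, s, x(s))] at the
    left end of each cell, the exponential weights being integrated exactly.  On
    the cell starting at [jh] the frozen value is off by at most
      [Ef h + Lf (K h + delta)]   resp.   [Eg h + Lg (K h + delta)],
    where [K] is the Lipschitz constant of [x] and [delta] the supremum of the
    node errors.  The weights have total mass at most [1 / |alpha1|] resp.
    [1 / beta], uniformly in [t] (this is where [0 <= alpha2],
    [alpha1 <= alpha2] and [gamma <= beta] enter), so that every node error is at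
    most [C h + q delta] with [q = Lf / |alpha1| + Lg / beta < 1].  Taking the
    supremum, which is finite because [S] is bounded, gives
    [delta <= C h / (1 - q)].

    That [x] is Lipschitz needs no fixed-point or Gronwall argument: in
    [x = x0 + volterra + fredholm] each integral term is Lipschitz, because moving
    [t] changes the bounds of integration, where the weights are at most [1], the
    weights, by a factor [1 - exp (- r)] with [r = O(|t - u|)], and the first
    argument of the integrand, which has bounded partial derivative
    ([volterra_lipschitz], [fredholm_lipschitz]).

    The norm [N] is arbitrary whereas integrals and limits are taken
    coordinatewise, and the contraction constant [q] leaves no room for
    equivalence constants.  The sharp inequalities
      [N (int w F) <= sup N(F) * int w]   and
      [N (phi b - phi a) <= sup N(phi') * (b - a)]
    are reduced to real-valued functions by a norming functional, a linear form
    dominated by [N] and equal to [N] at a given vector ([norming_functional]).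
    Equivalence of [N] with the sup norm only serves to justify integrability
    over half-lines and convergence of the infinite sums
    ([vintegrable_tail], [quadrature_error_tail]). *)

Lemma half_lineE (R : realType) (t : R) : half_line R t = (0 <= t) :> Prop.
Proof. by rewrite /half_line /= in_itv /= andbT. Qed.


(** * Norming functionals *)

Section Sublinear.
Context {R : realType} {n : nat}.
Implicit Types (p q : 'rV[R]_n -> R) (u v w c : 'rV[R]_n).

Definition sublinear p : Prop :=
  (forall x y, p (x + y) <= p x + p y) /\
  (forall a x, 0 <= a -> p (a *: x) = a * p x).

(** The largest minorant of [p] of the form [x |-> p (x + t u) - t p(u)]: it is
    again sublinear and is linear along [u].  Applying it along a spanning family
    turns a sublinear function into a linear one, which gives the Hahn-Banach
    theorem in finite dimension. *)
Definition shrink p u : 'rV[R]_n -> R :=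
  fun x => inf [set p (x + t *: u) - t * p u | t in half_line R].

Let sublinear0 p : sublinear p -> p 0 = 0.
Proof. by move=> [_ pZ]; rewrite -(scale0r (0 : 'rV[R]_n)) pZ // mul0r. Qed.

Lemma sublinear_ge0 p : sublinear p -> forall x, 0 <= p x + p (- x).
Proof. by move=> sp x; rewrite -(sublinear0 sp) -(subrr x); apply: sp.1. Qed.

Lemma shrink_has_inf p u x : sublinear p ->
  has_inf [set p (x + t *: u) - t * p u | t in half_line R].
Proof.
move=> sp; split; first by exists (p (x + 0 *: u) - 0 * p u), 0 => //=;
  rewrite half_lineE.
exists (- p (- x)) => _ [t /= + <-]; rewrite half_lineE => t0.
rewrite lerBrDr addrC -sp.2 // lerBlDr.
by have := sp.1 (x + t *: u) (- x); rewrite addrAC subrr add0r.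
Qed.

Lemma shrink_le p u x t : sublinear p -> 0 <= t ->
  shrink p u x <= p (x + t *: u) - t * p u.
Proof.
move=> sp t0; apply: ge_inf; first exact: (shrink_has_inf u x sp).2.
by exists t; rewrite ?half_lineE.
Qed.

Lemma le_shrink p u x b : sublinear p ->
  (forall t, 0 <= t -> b <= p (x + t *: u) - t * p u) -> b <= shrink p u x.
Proof.
move=> sp h; apply: lb_le_inf; first exact: (shrink_has_inf u x sp).1.
by move=> _ [t /= + <-]; rewrite half_lineE; exact: h.
Qed.

Lemma sublinear_shrink p u : sublinear p -> sublinear (shrink p u).
Proof.
move=> sp.
have pZ a x : 0 < a -> a * shrink p u x <= shrink p u (a *: x).
  move=> a0; apply: le_shrink => // t t0.
  rewrite -ler_pdivlMl //.
  apply: le_trans (shrink_le u x sp (_ : 0 <= a^-1 * t)) _.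
    by rewrite mulr_ge0 // invr_ge0 ltW.
  have a0' := ltW a0; have aN0 : a != 0 by rewrite gt_eqF.
  rewrite mulrBr mulrA -[a^-1 * p _]sp.2 ?invr_ge0 //.
  by rewrite scalerDr !scalerA mulVf // scale1r.
have p0 : shrink p u 0 = 0.
  apply/eqP; rewrite eq_le; apply/andP; split.
    have := shrink_le u 0 sp (lexx 0).
    by rewrite scale0r mul0r addr0 (sublinear0 sp) subr0.
  by apply: le_shrink => // t t0; rewrite add0r sp.2 // subrr.
split=> [x y|a x].
  rewrite -lerBlDr; apply: le_shrink => // s s0; rewrite lerBlDr -lerBlDl.
  apply: le_shrink => // t t0; rewrite lerBlDl.
  apply: le_trans (shrink_le u (x + y) sp (addr_ge0 s0 t0)) _.
  have := sp.1 (x + s *: u) (y + t *: u).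
  by rewrite scalerDl addrACA; lra.
rewrite le_eqVlt => /predU1P[<-|a0]; first by rewrite scale0r mul0r.
apply/eqP; rewrite eq_le pZ // andbT -ler_pdivrMl //.
have := pZ a^-1 (a *: x); rewrite invr_gt0 scalerA mulVf ?gt_eqF // scale1r.
exact.
Qed.

Lemma shrink_le_self p u x : sublinear p -> shrink p u x <= p x.
Proof.
by move=> sp; have := shrink_le u x sp (lexx 0); rewrite scale0r addr0 mul0r subr0.
Qed.

(** Together with [shrink p u u <= p u] and sublinearity, this forces
    [shrink p u (- u) = - shrink p u u = - p u]. *)
Lemma shrink_opp p u : sublinear p -> shrink p u (- u) <= - p u.
Proof.
move=> sp; have := shrink_le u (- u) sp ler01.
by rewrite scale1r addNr (sublinear0 sp) mul1r sub0r.
Qed.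

Lemma sublinear_flatten p (us : seq 'rV[R]_n) : sublinear p ->
  exists q, [/\ sublinear q, forall x, q x <= p x &
    forall u, u \in us -> q u + q (- u) <= 0].
Proof.
elim: us p => [|u us IH] p sp; first by exists p; split.
have [q [sq qp qus]] := IH _ (sublinear_shrink u sp).
exists q; split=> // [x|w].
  exact: le_trans (qp x) (shrink_le_self _ _ sp).
rewrite inE => /predU1P[->|]; last exact: qus.
have := qp u; have := qp (- u); have := shrink_opp u sp.
by have := shrink_le_self u u sp; lra.
Qed.

Definition dot c w : R := \sum_k c 0 k * w 0 k.

Lemma dot_is_additive c : zmod_morphism (dot c).
Proof.
move=> u v; rewrite /dot -sumrB; apply: eq_bigr => k _.
by rewrite !mxE mulrBr.
Qed.

HB.instance Definition _ c :=
  GRing.isZmodMorphism.Build _ _ (dot c) (dot_is_additive c).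

Lemma dotZ c a w : dot c (a *: w) = a * dot c w.
Proof. by rewrite /dot mulr_sumr; apply: eq_bigr => k _; rewrite mxE mulrCA. Qed.

(** [N] is first made linear along [v], which pins the value at [v] to [N v], then
    along the canonical basis, which makes it a linear form. *)
Lemma norming_functional (N : 'rV[R]_n -> R) v : is_norm N ->
  exists2 c, dot c v = N v & forall w, dot c w <= N w.
Proof.
move=> nN.
have sN : sublinear N.
  split; first exact: is_norm_triangle nN.
  by move=> a x a0; rewrite (is_norm_homo nN) ger0_norm.
have [q [sq qp qe]] := sublinear_flatten
  [seq delta_mx 0 k | k <- enum 'I_n] (sublinear_shrink v sN).
have qle a k : q (a *: delta_mx 0 k) <= a * q (delta_mx 0 k).
  have [a0|a0] := leP 0 a; first by rewrite sq.2.
  have a0' : 0 <= - a by rewrite oppr_ge0 ltW.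
  rewrite -[a in leLHS]opprK scaleNr -scalerN sq.2 //.
  rewrite mulNr -mulrN ler_nM2l //.
  have /qe : (delta_mx 0 k : 'rV[R]_n) \in [seq delta_mx 0 k | k <- enum 'I_n].
    by apply/mapP; exists k => //; rewrite mem_enum.
  lra.
pose c : 'rV[R]_n := \row_k q (delta_mx 0 k).
have q_dot x : q x <= dot c x.
  rewrite {1}(row_sum_delta x) /dot.
  elim/big_ind2 : _ => [|y1 b y2 d h1 h2|k _].
  - by rewrite (sublinear0 sq).
  - exact: le_trans (sq.1 _ _) (lerD h1 h2).
  - by rewrite mxE mulrC.
have dot_q x : dot c x <= q x.
  (* The reverse bound is [q_dot] at [- x]. *)
  have := q_dot (- x); rewrite raddfN /=; have := sublinear_ge0 sq x; lra.
have dN w : dot c w <= N w.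
  exact: le_trans (dot_q w) (le_trans (qp w) (shrink_le_self _ _ sN)).
exists c => //; apply/eqP; rewrite eq_le dN /=.
have := dot_q (- v); rewrite raddfN /=; have := qp (- v).
have := shrink_opp v sN; lra.
Qed.

End Sublinear.

(** * Elementary consequences of the norm axioms *)

Section NormFacts.
Context {R : realType} {n : nat} (N : 'rV[R]_n -> R).
Hypothesis nN : is_norm N.

Lemma norm0 : N 0 = 0.
Proof. by rewrite -(scale0r (0 : 'rV[R]_n)) (is_norm_homo nN) normr0 mul0r. Qed.

Lemma normN v : N (- v) = N v.
Proof. by rewrite -scaleN1r (is_norm_homo nN) normrN1 mul1r. Qed.

Lemma norm_ge0 v : 0 <= N v.
Proof.
by have := is_norm_triangle nN v (- v); rewrite subrr norm0 normN; lra.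
Qed.

Lemma norm_sub_le u v w : N (u - w) <= N (u - v) + N (v - w).
Proof. by rewrite -[u - w](subrKA v); exact: is_norm_triangle. Qed.

Lemma norm_subC u v : N (u - v) = N (v - u).
Proof. by rewrite -normN opprB. Qed.

Lemma norm_sum_le (I : Type) (r : seq I) (P : pred I) (F : I -> 'rV[R]_n)
    (b : I -> R) :
  (forall i, P i -> N (F i) <= b i) ->
  N (\sum_(i <- r | P i) F i) <= \sum_(i <- r | P i) b i.
Proof.
move=> Fb; elim/big_ind2 : _ => // [|x1 x2 y1 y2 h1 h2]; first by rewrite norm0.
exact: le_trans (is_norm_triangle nN _ _) (lerD h1 h2).
Qed.

Lemma coord_le_mx_norm (v : 'rV[R]_n) k : `|v 0 k| <= `|v|.
Proof.
rewrite [leRHS]/Num.Def.normr /= mx_normrE; apply/bigmax_geP; right => /=.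
by exists (0, k).
Qed.

Lemma norm_le_mx_norm : exists2 K, 0 < K & forall v, N v <= K * `|v|.
Proof.
exists (1 + \sum_k N (delta_mx 0 k)) => [|v].
  by rewrite ltr_pwDl // sumr_ge0 // => k _; exact: norm_ge0.
apply: (@le_trans _ _ (\sum_k N (delta_mx 0 k) * `|v|)).
  rewrite {1}(row_sum_delta v); apply: norm_sum_le => k _.
  rewrite (is_norm_homo nN) mulrC ler_wpM2l ?norm_ge0 //.
  exact: coord_le_mx_norm.
by rewrite -mulr_suml ler_wpM2r // lerDr.
Qed.

Lemma continuous_norm : continuous N.
Proof.
have [K K0 NK] := norm_le_mx_norm.
move=> v; have Fv : Filter (nbhs v) by exact: (@nbhs_filter 'rV[R]_n v).
apply/cvgrPdist_le => e e0.
have e0' : 0 < K^-1 * e by rewrite mulr_gt0 // invr_gt0.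
have /cvgrPdist_le/(_ _ e0') : (w : 'rV[R]_n) @[w --> v] --> v by exact: cvg_id.
apply: filterS => w vw.
have h1 : N v <= N w + N (v - w).
  by have := is_norm_triangle nN w (v - w); rewrite addrC subrK.
have h2 : N w <= N v + N (v - w).
  by have := is_norm_triangle nN v (w - v); rewrite addrC subrK norm_subC.
have : N (v - w) <= e by rewrite (le_trans (NK _)) // -ler_pdivlMl.
by rewrite ler_distlC; lra.
Qed.

(** By compactness [N] has a positive minimum on the unit sphere of the sup norm;
    homogeneity propagates the bound. *)
Lemma mx_norm_le_norm : exists2 M, 0 < M & forall v, `|v| <= M * N v.
Proof.
pose A := [set v : 'rV[R]_n | `|v| = 1].
have [[v0 Av0]|A0] := pselect (A !=set0); last first.
  exists 1 => // v; have [->|v_neq0] := eqVneq v 0.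
    by rewrite normr0 norm0 mulr0.
  exfalso; apply: A0; exists (`|v|^-1 *: v).
  by rewrite /A /= normrZ normfV normr_id mulVf // normr_eq0.
have cA : compact A.
  apply: bounded_closed_compact.
    by exists 1; split=> // x x1 v /= ->; exact: ltW.
  apply: (@preimage_closed _ _ (fun v : 'rV[R]_n => `|v|) [set x | x = 1]).
  - by move=> v _; exact: norm_continuous.
  - exact: closed_eq.
have [||c Ac minc] := @EVT_min_rV R n N A _ cA; first by exists v0.
  exact/continuous_subspaceT/continuous_norm.
have {}Ac : `|c| = 1 by move: Ac; rewrite inE.
have c_gt0 : 0 < N c.
  rewrite lt_neqAle norm_ge0 andbT eq_sym; apply/eqP => /(is_norm_eq0 nN) c0.
  by move: Ac; rewrite c0 normr0 => /eqP; rewrite eq_sym oner_eq0.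
exists (N c)^-1 => [|v]; first by rewrite invr_gt0.
have [->|v_neq0] := eqVneq v 0; first by rewrite normr0 norm0 mulr0.
have v_gt0 : 0 < `|v| by rewrite normr_gt0.
rewrite ler_pdivlMl // mulrC -ler_pdivlMl //.
have := minc (`|v|^-1 *: v).
rewrite (is_norm_homo nN) normfV normr_id; apply.
by rewrite inE /A /= normrZ normfV normr_id mulVf ?gt_eqF.
Qed.

End NormFacts.

(** * Mean value inequality *)

Section MeanValue.
Context {R : realType} {n : nat} (N : 'rV[R]_n -> R).
Hypothesis nN : is_norm N.

Lemma continuous_dot (c : 'rV[R]_n) : continuous (dot c : 'rV[R]_n -> R).
Proof.
move=> v; have Fv : Filter (nbhs v) by exact: (@nbhs_filter 'rV[R]_n v).
rewrite /continuous_at /dot; apply: cvg_big => [|k _].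
  by move=> x; exact: add_continuous.
by apply: cvgMl_tmp; exact: coord_continuous.
Qed.

(** Passes from difference quotients in [u] within [A] to difference quotients in
    the increment [h], the form on which [is_derive] is built. *)
Lemma cvg_shift_within (A : set R) t : nbhs t A ->
  (fun h : R => h + t) @ 0^' --> within A t^'.
Proof.
move=> tA U; rewrite /= /within /= => tU.
have /nbhs_ballP[e /= e0 eU] : nbhs t (fun u => u != t -> U u).
  by apply: filterS2 tA tU => u Au uU ut; exact: uU.
apply/nbhs_ballP; exists e => //= h he h0; apply: eU.
  by move: he; rewrite /ball /= sub0r normrN opprD addrCA subrr addr0 normrN.
by rewrite -subr_eq0 addrK.
Qed.

Lemma is_derive_dot (A : set R) (phi : R -> 'rV[R]_n) t d c : nbhs t A ->
  is_derive_within A phi t d ->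
  is_derive t 1 (fun u => dot c (phi u) : R) (dot c d).
Proof.
move=> tA phid.
suff h : (fun h : R => h^-1 *: (((fun u => dot c (phi u)) \o shift t) (h *: (1:R))
    - dot c (phi t))) @ 0^' --> dot c d.
  by apply: DeriveDef; [apply/cvg_ex; exists (dot c d) | exact/cvg_lim].
have := cvg_comp _ _ (cvg_comp _ _ (cvg_shift_within tA) phid)
  (@continuous_dot c d).
apply: cvg_trans.
apply: near_eq_cvg; near=> h.
by rewrite /= /shift /= addrK dotZ raddfB /= [h *: 1]mulr1.
Unshelve. all: by end_near. Qed.

Lemma is_derive_within_cvg (A : set R) (phi : R -> 'rV[R]_n) t d :
  is_derive_within A phi t d -> phi @ within A (nbhs t) --> phi t.
Proof.
move=> phid.
have h : (fun u => phi t + (u - t) *: ((u - t)^-1 *: (phi u - phi t))) @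
    within A t^' --> phi t + (t - t) *: d.
  apply: cvgD; first exact: cvg_cst.
  apply: cvgZ => //; apply: cvgB; last exact: cvg_cst.
  by move=> U tU; apply: filterS tU => u Uu _ _.
rewrite subrr scale0r addr0 in h.
apply/cvgrPdist_le => e e0; move/cvgrPdist_le/(_ e e0) : h.
rewrite !near_withinE; apply: filterS => u hu Au.
have [->|ut] := eqVneq u t; first by rewrite subrr normr0 ltW.
have := hu ut Au; rewrite scalerA divff ?subr_eq0 // scale1r.
by rewrite [phi t + (phi u - _)]addrC subrK.
Qed.

(** The scalar mean value theorem, applied to [dot c o phi] for a functional [c]
    norming [phi b - phi a]. *)
Lemma mean_value_inequality (A : set R) (phi d : R -> 'rV[R]_n) a b D :
  a <= b -> `[a, b] `<=` A ->
  (forall t, `[a, b]%classic t -> is_derive_within A phi t (d t)) ->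
  (forall t, `[a, b]%classic t -> N (d t) <= D) ->
  N (phi b - phi a) <= D * (b - a).
Proof.
move=> ab abA phid dD.
have [c <- cN] := norming_functional (phi b - phi a) nN.
have [|||s sab e] := @MVT_segment R (fun u => dot c (phi u)) (fun t => dot c (d t)) a b.
- exact: ab.
- move=> t tab; apply: (@is_derive_dot A); last first.
    by apply: phid; move: tab; rewrite /= !in_itv /= => /andP[/ltW-> /ltW->].
  have : nbhs t `]a, b[%classic by apply: near_in_itvoo.
  apply: filterS => u /= uab; apply: abA; move: uab.
  by rewrite /= !in_itv /= => /andP[/ltW-> /ltW->].
- apply/subspace_continuousP => t tab.
  apply: (cvg_comp _ _ (_ : phi @ within `[a, b] (nbhs t) --> phi t)).
    apply: cvg_trans (is_derive_within_cvg (phid t tab)).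
    apply: cvg_app; apply: (@within_subset _ _ _ _ _ abA).
  exact: continuous_dot.
rewrite raddfB /= e ler_wpM2r ?subr_ge0 //.
by apply: le_trans (cN _) _; apply: dD.
Qed.

End MeanValue.

(** * Integrals of vector-valued functions *)

Section VectorIntegral.
Context {R : realType} {n : nat}.
Local Notation mu := (@lebesgue_measure R).
Implicit Types (A B : set (measurableTypeR R)) (F G : R -> 'rV[R]_n) (w : R -> R).

Definition vintegrable A F : Prop :=
  forall k, mu.-integrable A (EFin \o (fun s => F s 0 k)).

Lemma vintegralB A F G : measurable A -> vintegrable A F -> vintegrable A G ->
  vintegral A (fun s => F s - G s) = vintegral A F - vintegral A G.
Proof.
move=> mA iF iG; apply/rowP => k; rewrite !mxE -RintegralB //.
by apply: eq_Rintegral => s _; rewrite !mxE.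
Qed.

Lemma vintegrableB A F G : measurable A -> vintegrable A F -> vintegrable A G ->
  vintegrable A (fun s => F s - G s).
Proof.
move=> mA iF iG k; have := integrableB mA (iF k) (iG k).
by apply: eq_integrable => // s _; rewrite /= !mxE.
Qed.

Lemma vintegrable_const A w (v : 'rV[R]_n) : measurable A -> mu.-integrable A (EFin \o w) ->
  vintegrable A (fun s => w s *: v).
Proof.
move=> mA iw k; have := integrableZr mA (v 0 k) iw.
by apply: eq_integrable => // s _; rewrite /= !mxE.
Qed.

Lemma vintegral_const A w (v : 'rV[R]_n) : measurable A -> mu.-integrable A (EFin \o w) ->
  vintegral A (fun s => w s *: v) = (\int[mu]_(s in A) w s) *: v.
Proof.
move=> mA iw; apply/rowP => k; rewrite !mxE -RintegralZr //.
by apply: eq_Rintegral => s _; rewrite !mxE.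
Qed.

Lemma vintegrableS A B F : measurable A -> measurable B -> B `<=` A ->
  vintegrable A F -> vintegrable B F.
Proof. by move=> mA mB BA iF k; exact: integrableS (iF k). Qed.

Lemma Rintegral_split a c (b : itv_bound R) (F : R -> R) :
  mu.-integrable [set` Interval (BLeft a) b] (EFin \o F) ->
  a <= c -> (BRight c <= b)%O ->
  \int[mu]_(s in [set` Interval (BLeft a) b]) F s =
  \int[mu]_(s in `[a, c]) F s + \int[mu]_(s in [set` Interval (BLeft c) b]) F s.
Proof.
move=> iF ac cb; apply/eqP; rewrite addrC -subr_eq Rintegral_itvB //.
rewrite Rintegral_itv_obnd_cbnd //.
by apply: integrableS iF => //; apply: subset_itvr; rewrite bnd_simp.
Qed.

Lemma vintegral_split a c (b : itv_bound R) F :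
  vintegrable [set` Interval (BLeft a) b] F -> a <= c -> (BRight c <= b)%O ->
  vintegral [set` Interval (BLeft a) b] F =
  vintegral `[a, c] F + vintegral [set` Interval (BLeft c) b] F.
Proof.
by move=> iF ac cb; apply/rowP => k; rewrite !mxE; exact: Rintegral_split.
Qed.

Lemma dot_vintegral A F c : measurable A -> vintegrable A F ->
  mu.-integrable A (EFin \o (fun s => dot c (F s))) /\
  dot c (vintegral A F) = \int[mu]_(s in A) dot c (F s).
Proof.
move=> mA iF; rewrite /dot.
under [X in X = _]eq_bigr do rewrite mxE.
elim: (index_enum _) => [|k r [IH1 IH2]].
  rewrite big_nil; split.
    apply: eq_integrable (integrable0 mu A) => // s _.
    by rewrite /= big_nil.
  by under eq_Rintegral do rewrite big_nil; rewrite Rintegral_cst // mul0r.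
have ik : mu.-integrable A (EFin \o (fun s => c 0 k * F s 0 k)).
  by have := integrableZl mA (c 0 k) (iF k); apply: eq_integrable.
split.
  have := integrableD mA ik IH1.
  by apply: eq_integrable => // s _; rewrite /= big_cons.
rewrite big_cons IH2 -RintegralZl // -RintegralD //.
by apply: eq_Rintegral => s _; rewrite big_cons.
Qed.

(** Sharp for an arbitrary norm: a functional norming the integral commutes with
    the integral and is dominated by [N] inside it. *)
Lemma norm_vintegral_le N A w F (b : R) : is_norm N -> measurable A ->
  vintegrable A (fun s => w s *: F s) -> mu.-integrable A (EFin \o w) ->
  (forall s, A s -> 0 <= w s) -> (forall s, A s -> N (F s) <= b) ->
  N (vintegral A (fun s => w s *: F s)) <= b * \int[mu]_(s in A) w s.
Proof.
move=> nN mA iF iw w0 FB.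
have [c <- cN] := norming_functional (vintegral A (fun s => w s *: F s)) nN.
have [iFc ->] := dot_vintegral c mA iF.
rewrite -RintegralZl //; apply: le_Rintegral => //.
  by have := integrableZl mA b iw; apply: eq_integrable.
move=> s As; rewrite dotZ mulrC ler_wpM2r ?w0 //.
exact: le_trans (cN _) (FB _ As).
Qed.

Lemma continuous_within_coord A F k : {within A, continuous F} ->
  {within A, continuous (fun s => F s 0 k)}.
Proof.
move=> /subspace_continuousP cF; apply/subspace_continuousP => t At.
exact: cvg_comp _ _ (cF t At) (@coord_continuous R 1 n 0 k (F t)).
Qed.

End VectorIntegral.

(** * Exponential weights *)

Section ExpWeights.
Context {R : realType}.
Local Notation mu := (@lebesgue_measure R).
Implicit Types (p q a b s : R).

Lemma continuous_expw p q : continuous (fun s : R => expR (p * s + q)).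
Proof.
move=> s; apply: (@continuous_comp R R R (fun s => p * s + q) (@expR R)).
  by apply: cvgD; [apply: cvgMl_tmp; exact: cvg_id|exact: cvg_cst].
exact: continuous_expR.
Qed.

Lemma is_derive_expw p q (s : R) : p != 0 ->
  is_derive s 1 (fun s : R => p^-1 * expR (p * s + q)) (expR (p * s + q)).
Proof.
move=> p0; apply: is_derive_eq.
by rewrite addr0 /GRing.scale /= mulr1 mulrCA mulVf ?mulr1.
Qed.

Lemma integrable_expw_seg p q a b :
  mu.-integrable `[a, b] (EFin \o (fun s => expR (p * s + q))).
Proof.
apply: continuous_compact_integrable; first exact: segment_compact.
exact/continuous_subspaceT/continuous_expw.
Qed.

Lemma integral_expw_seg p q a b : p != 0 -> a <= b ->
  \int[mu]_(s in `[a, b]) expR (p * s + q) =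
  p^-1 * expR (p * b + q) - p^-1 * expR (p * a + q).
Proof.
move=> p0; rewrite le_eqVlt => /predU1P[<-|ab].
  by rewrite set_itv1 Rintegral_set1 subrr.
rewrite /Rintegral (@continuous_FTC2 _ _ (fun s => p^-1 * expR (p * s + q))) //.
- exact/continuous_subspaceT/continuous_expw.
- split=> [s _||].
  + by have [] := is_derive_expw q s p0.
  + apply: cvg_at_right_filter. apply: cvgMl_tmp; exact: continuous_expw.
  + apply: cvg_at_left_filter. apply: cvgMl_tmp; exact: continuous_expw.
- by move=> s _; rewrite derive1E; have [_ ->] := is_derive_expw q s p0.
Qed.

Lemma cvg_expw_pinfty p q : p < 0 -> expR (p * s + q) @[s --> +oo] --> (0 : R).
Proof.
move=> p0; rewrite -[X in _ --> X](mul0r (expR q)).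
under eq_fun do rewrite expRD.
apply: cvgMr_tmp.
under eq_fun => s do rewrite -[p * s]opprK -mulNr.
apply: (@cvg_comp _ _ _ (fun s => - p * s) (fun s => expR (- s))
  _ (pinfty_nbhs R)); last exact: cvgr_expR.
by apply: gt0_cvgMry; rewrite ?oppr_gt0 //; exact: cvg_id.
Qed.

Lemma integral_expw_tail p q a : p < 0 ->
  mu.-integrable `[a, +oo[ (EFin \o (fun s => expR (p * s + q))) /\
  \int[mu]_(s in `[a, +oo[) expR (p * s + q) = - p^-1 * expR (p * a + q).
Proof.
move=> p0; have pN0 : p != 0 by rewrite lt_eqF.
have h : (\int[mu]_(s in `[a, +oo[) (expR (p * s + q))%:E =
    0%:E - (p^-1 * expR (p * a + q))%:E)%E.
  apply: (@ge0_continuous_FTC2y _ _ (fun s => p^-1 * expR (p * s + q))).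
  - by move=> s _; exact: expR_ge0.
  - exact/continuous_subspaceT/continuous_expw.
  - rewrite -[X in _ --> X](mulr0 p^-1); apply: cvgMl_tmp.
    exact: cvg_expw_pinfty.
  - by move=> s _; have [] := is_derive_expw q s pN0.
  - apply: cvg_at_right_filter; apply: cvgMl_tmp; exact: continuous_expw.
  - by move=> s _; rewrite derive1E; have [_ ->] := is_derive_expw q s pN0.
split; last first.
  by rewrite /Rintegral h -EFinB /= sub0r mulNr.
apply/integrableP; split.
  apply/measurable_EFinP; apply: measurable_funTS.
  by apply: continuous_measurable_fun; exact: continuous_expw.
rewrite [X in (X < _)%E](_ : _ = (\int[mu]_(s in `[a, +oo[) (expR (p * s + q))%:E)%E).
  by rewrite h -EFinB ltry.
by apply: eq_integral => s _; rewrite gee0_abs // lee_fin expR_ge0.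
Qed.

End ExpWeights.

Section WeightedIntegrals.
Context {R : realType} {n : nat} (N : 'rV[R]_n -> R).
Hypothesis nN : is_norm N.
Local Notation mu := (@lebesgue_measure R).
Implicit Types (p q a b C : R) (F : R -> 'rV[R]_n).

Lemma continuous_expw_coord p q (A : set R) F k : {within A, continuous F} ->
  {within A, continuous (fun s => expR (p * s + q) * F s 0 k : R)}.
Proof.
move=> /(continuous_within_coord (k := k))/subspace_continuousP cF.
apply/subspace_continuousP => s As; apply: cvgM; last exact: cF.
by apply: cvg_within_filter; exact: continuous_expw.
Qed.

Lemma vintegrable_seg p q a b F : {within `[a, b], continuous F} ->
  vintegrable `[a, b] (fun s => expR (p * s + q) *: F s).
Proof.
move=> cF k.
have : mu.-integrable `[a, b] (EFin \o (fun s => expR (p * s + q) * F s 0 k)).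
  apply: continuous_compact_integrable; first exact: segment_compact.
  exact: continuous_expw_coord.
by apply: eq_integrable => // s _; rewrite /= mxE.
Qed.

(** The bound on [N (F s)] controls each coordinate because the norms are
    equivalent. *)
Lemma vintegrable_tail p q a C F : p < 0 ->
  {within `[a, +oo[, continuous F} ->
  (forall s, a <= s -> N (F s) <= C) ->
  vintegrable `[a, +oo[ (fun s => expR (p * s + q) *: F s).
Proof.
move=> p0 cF FC k; have [M M0 NM] := mx_norm_le_norm nN.
have [iw _] := integral_expw_tail q a p0.
have mI : measurable (`[a, +oo[%classic : set (measurableTypeR R)).
  exact: measurable_itv.
have := integrableZl mI (M * C) iw.
apply: le_integrable => //.
  have mf : measurable_fun (`[a, +oo[ : set R)
      (fun s => expR (p * s + q) * F s 0 k).
    apply: subspace_continuous_measurable_fun => //.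
    exact: continuous_expw_coord.
  apply/measurable_EFinP; apply: eq_measurable_fun mf => s _.
  by rewrite mxE.
move=> s; rewrite /= in_itv /= andbT => sa.
rewrite lee_fin mxE normrM mulrC normrM.
rewrite ler_wpM2r //; apply: le_trans (coord_le_mx_norm _ _) _.
apply: le_trans (NM _) _; apply: le_trans (ler_norm _).
by rewrite ler_wpM2l ?FC // ltW.
Qed.

Lemma integral_expw_ge0 p q (A : set (measurableTypeR R)) :
  0 <= \int[mu]_(s in A) expR (p * s + q).
Proof. by apply: Rintegral_ge0 => s _; exact: expR_ge0. Qed.

(** Used for the change of an exponential weight times the integrand when the
    outer variable moves: the cost is first order in the exponent [r]. *)
Lemma damped_diff_le r (u v : 'rV[R]_n) : 0 <= r ->
  N (expR (- r) *: u - v) <= N (u - v) + r * N v.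
Proof.
move=> r0; have e1 : expR (- r) <= 1 by rewrite expR_le1 oppr_le0.
have -> : expR (- r) *: u - v = expR (- r) *: (u - v) + (expR (- r) - 1) *: v.
  by rewrite scalerBr scalerBl scale1r addrA subrK.
apply: le_trans (is_norm_triangle nN _ _) _.
rewrite !(is_norm_homo nN); apply: lerD.
  by rewrite ger0_norm ?expR_ge0 // ler_piMl // norm_ge0.
rewrite ler_wpM2r ?norm_ge0 // ler0_norm ?subr_le0 //.
by have := expR_ge1Dx (- r); lra.
Qed.

End WeightedIntegrals.

Section KernelBounds.
Context {R : realType}.
Local Notation mu := (@lebesgue_measure R).
Implicit Types (s t u : R).

Lemma volterra_exponent_le0 (a1 a2 s t : R) : 0 <= a2 -> a1 <= a2 ->
  0 <= s <= t -> a1 * s - a2 * t <= 0.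
Proof. by move=> a20 a12 /andP[s0 st]; nra. Qed.

Lemma volterra_weight_le (a1 a2 t : R) : a1 != 0 -> 0 <= a2 -> a1 <= a2 ->
  0 <= t -> \int[mu]_(s in `[0, t]) expR (a1 * s - a2 * t) <= `|a1|^-1.
Proof.
move=> a10 a20 a12 t0; rewrite integral_expw_seg // mulr0 add0r.
have e0 := expR_ge0 (a1 * t - a2 * t); have e0' := expR_ge0 (- (a2 * t)).
have e1 : expR (a1 * t - a2 * t) <= 1.
  by rewrite expR_le1 volterra_exponent_le0 // t0 lexx.
have e1' : expR (- (a2 * t)) <= 1 by rewrite expR_le1 oppr_le0 mulr_ge0.
have [a1gt|a1lt|a1eq] := ltgtP a1 0; last by rewrite a1eq eqxx in a10.
- rewrite ltr0_norm // invrN.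
  have : a1^-1 < 0 by rewrite invr_lt0.
  by nra.
- rewrite gtr0_norm //; have : 0 < a1^-1 by rewrite invr_gt0.
  by nra.
Qed.

Lemma fredholm_exponent_le0 (b c t s : R) : 0 < b -> c <= b ->
  0 <= t <= s -> - b * s + c * t <= 0.
Proof. by move=> b0 cb /andP[t0 ts]; nra. Qed.

Lemma fredholm_weight_le (b c t u : R) : 0 < b -> c <= b -> 0 <= t <= u ->
  \int[mu]_(s in `[u, +oo[) expR (- b * s + c * t) <= b^-1.
Proof.
move=> b0 cb tu; have bN0 : - b < 0 by rewrite oppr_lt0.
rewrite (integral_expw_tail _ _ bN0).2 invrN opprK ler_piMr //.
  by rewrite invr_ge0 ltW.
by rewrite expR_le1 fredholm_exponent_le0.
Qed.

End KernelBounds.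

(** * Quadrature with exact exponential weights *)

(** Joins the completeness of matrix spaces with their normed module structure, so
    that absolutely convergent series of vectors converge. *)
HB.instance Definition _ (R : realType) m n := Complete.on 'M[R]_(m, n).

Section Quadrature.
Context {R : realType}.
Local Notation mu := (@lebesgue_measure R).
Variable h : R.
Hypothesis h_gt0 : 0 < h.

Let node_le (i m : nat) : (i <= m)%N -> i%:R * h <= m%:R * h.
Proof. by move=> im; rewrite ler_pM2r // ler_nat. Qed.

Lemma cell_sub i j m : (i <= j < m)%N -> cell h j `<=` `[i%:R * h, m%:R * h].
Proof.
move=> /andP[ij jm] s; rewrite /cell /= !in_itv /= => /andP[s1 s2].
by rewrite (le_trans (node_le ij)) // (le_trans s2) // node_le.
Qed.

Lemma Rintegral_cells i m (F : R -> R) : (i <= m)%N ->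
  mu.-integrable `[i%:R * h, m%:R * h] (EFin \o F) ->
  \int[mu]_(s in `[i%:R * h, m%:R * h]) F s =
  \sum_(i <= j < m) \int[mu]_(s in cell h j) F s.
Proof.
elim: m => [|m IH].
  by rewrite leqn0 => /eqP->; rewrite set_itv1 Rintegral_set1 big_geq.
rewrite leq_eqVlt => /predU1P[<- _|im iF].
  by rewrite set_itv1 Rintegral_set1 big_geq.
rewrite ltnS in im.
rewrite (Rintegral_split iF (node_le im)); last first.
  by rewrite bnd_simp node_le.
rewrite IH // ?big_nat_recr //.
apply: integrableS iF => //; apply: subset_itvl.
by rewrite bnd_simp node_le.
Qed.

Context {n : nat} (N : 'rV[R]_n -> R).
Hypothesis nN : is_norm N.

(** Because the weight is integrated exactly, the error on a cell is the integral
    of the weight against [F s - c j]; in particular it does not see the slope of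
    the weight. *)
Lemma quadrature_error p q (F : R -> 'rV[R]_n) (c : nat -> 'rV[R]_n) B i m :
  (i <= m)%N -> {within `[i%:R * h, m%:R * h], continuous F} ->
  (forall j s, (i <= j < m)%N -> cell h j s -> N (F s - c j) <= B) ->
  N (vintegral `[i%:R * h, m%:R * h] (fun s => expR (p * s + q) *: F s)
     - \sum_(i <= j < m) (\int[mu]_(s in cell h j) expR (p * s + q)) *: c j)
  <= B * \int[mu]_(s in `[i%:R * h, m%:R * h]) expR (p * s + q).
Proof.
move=> im cF FcB.
have iF := vintegrable_seg p q cF.
have iw := integrable_expw_seg p q (i%:R * h) (m%:R * h).
have -> : vintegral `[i%:R * h, m%:R * h] (fun s => expR (p * s + q) *: F s) =
    \sum_(i <= j < m) vintegral (cell h j) (fun s => expR (p * s + q) *: F s).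
  apply/rowP => k; rewrite summxE !mxE Rintegral_cells //.
  by apply: eq_bigr => j _; rewrite mxE.
rewrite Rintegral_cells // mulr_sumr -sumrB !big_nat.
apply: norm_sum_le => // j ijm.
have mcell : measurable (cell h j : set (measurableTypeR R)).
  exact: measurable_itv.
have iFj : vintegrable (cell h j) (fun s => expR (p * s + q) *: F s).
  by apply: vintegrable_seg; apply: continuous_subspaceW cF; exact: cell_sub.
have iwj := integrable_expw_seg p q (j%:R * h) (j.+1%:R * h).
rewrite -vintegral_const // -vintegralB //; last exact: vintegrable_const.
have E : (fun s => expR (p * s + q) *: F s - expR (p * s + q) *: c j) =
    (fun s => expR (p * s + q) *: (F s - c j)).
  by apply/funext => s; rewrite scalerBr.
rewrite E; apply: norm_vintegral_le => // [|s]; last exact: FcB.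
by rewrite -E; apply: vintegrableB => //; exact: vintegrable_const.
Qed.

(** Truncate at the node [m h]: [quadrature_error] controls the finite part,
    uniformly in [m], and the remaining integral is at most [C] times a tail of
    the exponential, which vanishes as [m] grows. *)
Lemma quadrature_error_tail p q (F : R -> 'rV[R]_n) (c : nat -> 'rV[R]_n) B C i :
  p < 0 -> 0 <= B -> {within `[i%:R * h, +oo[, continuous F} ->
  (forall s, i%:R * h <= s -> N (F s) <= C) ->
  (forall j, (i <= j)%N -> N (c j) <= C) ->
  (forall j s, (i <= j)%N -> cell h j s -> N (F s - c j) <= B) ->
  N (vintegral `[i%:R * h, +oo[ (fun s => expR (p * s + q) *: F s)
     - limn (fun m => \sum_(i <= j < m)
               (\int[mu]_(s in cell h j) expR (p * s + q)) *: c j))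
  <= B * \int[mu]_(s in `[i%:R * h, +oo[) expR (p * s + q).
Proof.
move=> p0 B0 cF FC cC FcB.
set w := fun j => \int[mu]_(s in cell h j) expR (p * s + q).
set v := fun m => \sum_(i <= j < m) w j *: c j.
set V := vintegral _ _.
set W := \int[mu]_(s in _) _.
have [iw _] := integral_expw_tail q (i%:R * h) p0.
have w0 j : 0 <= w j by exact: integral_expw_ge0.
have iF := vintegrable_tail nN q p0 cF FC.
have W0 : 0 <= W by exact: integral_expw_ge0.
have segW m : (i <= m)%N ->
    \int[mu]_(s in `[i%:R * h, m%:R * h]) expR (p * s + q) <= W.
  move=> im; rewrite /W (Rintegral_split iw (node_le im)) // lerDl.
  exact: integral_expw_ge0.
have v_cvg : cvgn v.
  (* Absolute convergence: the norms of the terms are dominated by [M C w j]. *)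
  rewrite is_cvg_series_restrict; apply: normed_cvg.
  have [M M0 NM] := mx_norm_le_norm nN.
  rewrite -(is_cvg_series_restrict i).
  apply: nondecreasing_is_cvgn.
    apply/nondecreasing_seqP => m; have [im|mi] := leqP i m.
      by rewrite [leRHS]big_nat_recr //= lerDl.
    by rewrite [leLHS]big_geq ?(ltnW mi) //=; apply: sumr_ge0 => j _; exact: normr_ge0.
  exists (M * C * W) => _ [m _ <-] /=.
  have C0 : 0 <= C by apply: le_trans (FC _ (lexx _)); exact: norm_ge0.
  have [im|mi] := leqP i m; last first.
    by rewrite big_geq ?(ltnW mi) // mulr_ge0 // mulr_ge0 // ltW.
  apply: le_trans (ler_wpM2l _ (segW m im)); last by rewrite mulr_ge0 // ltW.
  rewrite Rintegral_cells //; last first.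
    exact: integrable_expw_seg.
  rewrite mulr_sumr !big_nat; apply: ler_sum => j /andP[ij _].
  rewrite normrZ ger0_norm // mulrC ler_wpM2r //.
  by rewrite (le_trans (NM _)) // ler_wpM2l ?cC // ltW.
have e_cvg : (fun m : nat => B * W + C * (- p^-1 * expR (p * (m%:R * h) + q)))
    @ \oo --> B * W + C * (- p^-1 * 0).
  apply: cvgD; first exact: cvg_cst.
  do 2 apply: cvgMl_tmp.
  under eq_fun do rewrite mulrCA mulrC.
  apply: (@cvg_comp _ _ _ (fun m : nat => m%:R) (fun s => expR (p * h * s + q))
    _ (pinfty_nbhs R)); first exact: cvgr_idn.
  by apply: cvg_expw_pinfty; rewrite nmulr_rlt0.
rewrite mulr0 mulr0 addr0 in e_cvg.
have d_cvg : (fun m => N (V - v m)) @ \oo --> N (V - limn v).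
  apply: (cvg_comp (fun m => V - v m) N); last exact: continuous_norm.
  by apply: cvgB; [exact: cvg_cst | exact: v_cvg].
apply: (ler_cvg_to d_cvg e_cvg); near=> m.
have im : (i <= m)%N by near: m; exact: nbhs_infty_ge.
rewrite /V (vintegral_split iF (node_le im)) // addrAC.
apply: le_trans (is_norm_triangle nN _ _) _; apply: lerD.
  apply: le_trans (quadrature_error p q im _
    (_ : forall j s, _ -> _ -> N (F s - c j) <= B)) _.
  - by apply: continuous_subspaceW cF; apply: subset_itvl.
  - by move=> j s /andP[ij _]; exact: FcB.
  - by rewrite ler_wpM2l // segW.
rewrite -(integral_expw_tail q (m%:R * h) p0).2.
apply: norm_vintegral_le => //.
- apply: vintegrableS iF => //; apply: subset_itvr.
  by rewrite bnd_simp node_le.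
- exact: (integral_expw_tail q (m%:R * h) p0).1.
- move=> s; rewrite /= in_itv /= andbT => ms; apply: FC.
  exact: le_trans (node_le im) ms.
Unshelve. all: by end_near. Qed.

End Quadrature.

(** * Regularity of the data and of the solution *)

Section Slices.
Context {R : realType} {n : nat} (N : 'rV[R]_n -> R).
Hypothesis nN : is_norm N.
Variables (D : set (R * R)) (S : set 'rV[R]_n) (F : R -> R -> 'rV[R]_n -> 'rV[R]_n).

(** Joint continuity along the curve [s |-> (t, s, x s)], which stays in the domain
    for [s] in [I]. *)
Lemma continuous_slice t (x : R -> 'rV[R]_n) (I : set R) :
  jointly_continuous D S F -> (forall s, I s -> D (t, s) /\ S (x s)) ->
  {within I, continuous x} -> {within I, continuous (fun s => F t s (x s))}.
Proof.
move=> /subspace_continuousP cF IDS /subspace_continuousP cx.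
apply/subspace_continuousP => s0 Is0.
have [Ds0 Ss0] := IDS s0 Is0.
have Fp := cF (t, s0, x s0) (conj Ds0 Ss0).
apply: (@cvg_comp _ _ _ (fun s => (t, s, x s))
  (fun p : R * R * 'rV[R]_n => F p.1.1 p.1.2 p.2) _ _ _ _ Fp).
have pI : (fun s => (t, s, x s)) @ within I (nbhs s0) --> (t, s0, x s0).
  have Fx : Filter (nbhs (x s0)) by exact: (@nbhs_filter 'rV[R]_n).
  apply: (@cvg_pair _ _ _ (within I (nbhs s0)) (nbhs (t, s0)) (nbhs (x s0))
    _ _ Fx (fun s => (t, s)) x); last exact: cx.
  apply: cvg_within_filter.
  apply: (@cvg_pair R R R (nbhs s0) (nbhs t) (nbhs s0)); last exact: cvg_id.
  exact: cvg_cst.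
move=> U UDS; have : nbhs s0 (fun s => I s -> (D `*` S) (t, s, x s) -> U (t, s, x s)).
  exact: pI UDS.
by apply: filterS => s hs Is; apply: hs => //; have [] := IDS s Is.
Qed.

Lemma C1_lipschitz_fst Mt Ms s y a b : C1_bounded N D S F Mt Ms ->
  S y -> a <= b -> (forall u, a <= u <= b -> D (u, s)) ->
  N (F b s y - F a s y) <= Mt * (b - a).
Proof.
move=> [Ft [Fs [dF [_ [FtM _]]]]] Sy ab abD.
have itv u : `[a, b]%classic u -> a <= u <= b by rewrite /= in_itv.
apply: (mean_value_inequality nN (A := [set u | D (u, s)])
  (phi := fun u => F u s y) (d := fun u => Ft u s y)) => //.
- by move=> u /itv /abD Dus; exact: (dF u s y Dus Sy).1.
- by move=> u /itv /abD Dus; exact: FtM.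
Qed.

Lemma C1_lipschitz_snd Mt Ms t y a b : C1_bounded N D S F Mt Ms ->
  S y -> a <= b -> (forall u, a <= u <= b -> D (t, u)) ->
  N (F t b y - F t a y) <= Ms * (b - a).
Proof.
move=> [Ft [Fs [dF [_ [_ FsM]]]]] Sy ab abD.
have itv u : `[a, b]%classic u -> a <= u <= b by rewrite /= in_itv.
apply: (mean_value_inequality nN (A := [set u | D (t, u)])
  (phi := fun u => F t u y) (d := fun u => Fs t u y)) => //.
- by move=> u /itv /abD Dtu; exact: (dF t u y Dtu Sy).2.
- by move=> u /itv /abD Dtu; exact: FsM.
Qed.

Lemma C1_bounded_ge0 Mt Ms t s y : C1_bounded N D S F Mt Ms ->
  S y -> D (t, s) -> 0 <= Mt /\ 0 <= Ms.
Proof.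
move=> [Ft [Fs [_ [_ [FtM FsM]]]]] Sy Dts; split.
  exact: le_trans (norm_ge0 nN _) (FtM _ _ _ Dts Sy).
exact: le_trans (norm_ge0 nN _) (FsM _ _ _ Dts Sy).
Qed.

(** The local error: [s] moves from [a] to [b] while the state moves from [z] to
    [y]. *)
Lemma increment_le Mt Ms L t a b y z : C1_bounded N D S F Mt Ms ->
  unif_lipschitz N D S F L -> S y -> S z -> a <= b ->
  (forall u, a <= u <= b -> D (t, u)) ->
  N (F t b y - F t a z) <= Ms * (b - a) + L * N (y - z).
Proof.
move=> FC1 FL Sy Sz ab abD.
apply: le_trans (norm_sub_le nN _ (F t a y) _) _; apply: lerD.
  exact: (C1_lipschitz_snd FC1).
by apply: FL => //; apply: abD; rewrite lexx.
Qed.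

(** The Lipschitz constants are not assumed nonnegative; a negative one is only
    possible when [S] has at most one point. *)
Lemma lipschitz_lt0 L t s y z : unif_lipschitz N D S F L -> D (t, s) -> L < 0 ->
  S y -> S z -> N (y - z) = 0.
Proof.
move=> FL Dts L0 Sy Sz; have := FL t s y z Dts Sy Sz.
have := norm_ge0 nN (F t s y - F t s z); have := norm_ge0 nN (y - z).
by nra.
Qed.

End Slices.

Section ScalarBound.
Context {R : realType}.
Local Notation mu := (@lebesgue_measure R).

Lemma integral_expw_seg_le (p q a b : R) : a <= b ->
  (forall s, a <= s <= b -> p * s + q <= 0) ->
  \int[mu]_(s in `[a, b]) expR (p * s + q) <= b - a.
Proof.
move=> ab pq.
have mI : measurable (`[a, b]%classic : set (measurableTypeR R)).
  exact: measurable_itv.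
have -> : b - a = \int[mu]_(s in `[a, b]) (cst 1 s).
  rewrite Rintegral_cst //= lebesgue_measure_itv /= lte_fin mul1r.
  by have [//|] := ltP a b; move=> ba; apply/eqP; rewrite subr_eq0 eq_le ba.
apply: le_Rintegral => //.
- exact: integrable_expw_seg.
- apply: continuous_compact_integrable; first exact: segment_compact.
  by apply: continuous_subspaceT => s; exact: cvg_cst.
- by move=> s; rewrite /= in_itv /= => /pq; rewrite expR_le1.
Qed.

End ScalarBound.

Section SolutionLipschitz.
Context {R : realType} {n : nat} (N : 'rV[R]_n -> R).
Hypothesis nN : is_norm N.
Local Notation mu := (@lebesgue_measure R).
Variables (S : set 'rV[R]_n) (x : R -> 'rV[R]_n).
Hypothesis x_cont : {within half_line R, continuous x}.
Hypothesis xS : forall t, 0 <= t -> S (x t).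

Section Volterra.
Variables (a1 a2 C Dt Ds : R) (f : R -> R -> 'rV[R]_n -> 'rV[R]_n).
Hypotheses (a1_neq0 : a1 != 0) (a2_ge0 : 0 <= a2) (a12 : a1 <= a2).
Hypothesis f_cont : jointly_continuous (dom_f R) S f.
Hypothesis f_bnd : unif_bounded N (dom_f R) S f C.
Hypothesis f_C1 : C1_bounded N (dom_f R) S f Dt Ds.

Definition volterra t : 'rV[R]_n :=
  vintegral `[0, t] (fun s => expR (a1 * s - a2 * t) *: f t s (x s)).

Lemma volterra_continuous a b t : 0 <= a -> b <= t ->
  {within `[a, b], continuous (fun s => f t s (x s))}.
Proof.
move=> a0 bt; apply: (continuous_slice f_cont) => [s|].
  rewrite /= in_itv /= => /andP[as_ sb]; have s0 := le_trans a0 as_.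
  by split; [rewrite /dom_f /= s0 (le_trans sb) | exact: xS].
apply: continuous_subspaceW x_cont => s.
by rewrite half_lineE /= in_itv /= => /andP[as_ _]; exact: le_trans a0 as_.
Qed.

(** Splitting at [t], the new piece over [[t, u]] has weight at most [1], and on
    [[0, t]] the weight for [u] is the weight for [t] damped by
    [exp (- alpha2 (u - t))]. *)
Lemma volterra_lipschitz t u : 0 <= t -> t <= u ->
  N (volterra u - volterra t) <= ((Dt + a2 * C) / `|a1| + C) * (u - t).
Proof.
move=> t0 tu; have u0 := le_trans t0 tu; have d0 : 0 <= u - t by rewrite subr_ge0.
have D00 : dom_f R (0, 0) by rewrite /dom_f /= lexx.
have C0 : 0 <= C by apply: le_trans (f_bnd D00 (xS (lexx 0))); exact: norm_ge0.
have [Dt0 _] := C1_bounded_ge0 nN f_C1 (xS (lexx 0)) D00.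
have mI : measurable (`[0, t]%classic : set (measurableTypeR R)).
  exact: measurable_itv.
have iu : vintegrable `[0, u] (fun s => expR (a1 * s - a2 * u) *: f u s (x s)).
  by apply: vintegrable_seg; exact: volterra_continuous.
have iut : vintegrable `[0, t] (fun s => expR (a1 * s - a2 * u) *: f u s (x s)).
  by apply: vintegrable_seg; exact: volterra_continuous.
have it : vintegrable `[0, t] (fun s => expR (a1 * s - a2 * t) *: f t s (x s)).
  by apply: vintegrable_seg; exact: volterra_continuous.
rewrite /volterra (vintegral_split iu t0) // addrAC -vintegralB // mulrDl.
apply: le_trans (is_norm_triangle nN _ _) _; apply: lerD.
  pose G s := expR (- (a2 * (u - t))) *: f u s (x s) - f t s (x s).
  have E : (fun s => expR (a1 * s - a2 * u) *: f u s (x s) -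
      expR (a1 * s - a2 * t) *: f t s (x s)) =
      (fun s => expR (a1 * s - a2 * t) *: G s).
    apply/funext => s; rewrite /G scalerBr scalerA -expRD.
    by congr (expR _ *: _ - _); ring.
  have iE := vintegrableB mI iut it; rewrite E in iE *.
  apply: le_trans (norm_vintegral_le (b := (Dt + a2 * C) * (u - t)) nN mI iE _ _ _) _.
  - exact: integrable_expw_seg.
  - by move=> s _; exact: expR_ge0.
  - move=> s; rewrite /= in_itv /= => /andP[s0 st].
    apply: le_trans (damped_diff_le nN _ _ _) _; first exact: mulr_ge0.
    rewrite mulrDl; apply: lerD.
      apply: (C1_lipschitz_fst nN f_C1) => //; first exact: xS.
      by move=> v /andP[tv _]; rewrite /dom_f /= s0 (le_trans st).
    rewrite [leRHS]mulrAC; apply: ler_wpM2l; first exact: mulr_ge0.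
    by apply: f_bnd; [rewrite /dom_f /= s0 | exact: xS].
  - rewrite [leRHS]mulrAC; apply: ler_wpM2l; last exact: volterra_weight_le.
    by rewrite mulr_ge0 // addr_ge0 // mulr_ge0.
apply: le_trans (norm_vintegral_le (b := C) nN _ _ _ _ _) _.
- exact: measurable_itv.
- by apply: vintegrable_seg; exact: volterra_continuous.
- exact: integrable_expw_seg.
- by move=> s _; exact: expR_ge0.
- move=> s; rewrite /= in_itv /= => /andP[ts su]; have s0 := le_trans t0 ts.
  by apply: f_bnd; [rewrite /dom_f /= s0 | exact: xS].
- apply: ler_wpM2l => //; apply: integral_expw_seg_le => // s /andP[ts su].
  by apply: volterra_exponent_le0 => //; rewrite (le_trans t0 ts).
Qed.

(** [quadrature_error] with the local error of [increment_le], the state error on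
    the cell starting at [j h] being at most [K h + Delta]. *)
Lemma volterra_quadrature K L Delta h i (y : nat -> 'rV[R]_n) :
  0 < h -> 0 <= K -> 0 <= L -> unif_lipschitz N (dom_f R) S f L ->
  (forall t u, 0 <= t -> t <= u -> N (x u - x t) <= K * (u - t)) ->
  (forall j, S (y j)) -> (forall j : nat, N (x (j%:R * h) - y j) <= Delta) ->
  N (volterra (i%:R * h) - \sum_(0 <= j < i)
       weight_f a1 a2 h i j *: f (i%:R * h) (j%:R * h) (y j))
  <= (Ds * h + L * (K * h + Delta)) / `|a1|.
Proof.
move=> h0 K0 L0 fL xK yS yD.
have h0' := ltW h0.
have D00 : dom_f R (0, 0) by rewrite /dom_f /= lexx.
have [_ Ds0] := C1_bounded_ge0 nN f_C1 (xS (lexx 0)) D00.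
have Delta0 : 0 <= Delta := le_trans (norm_ge0 nN _) (yD 0%N).
have ih0 : 0 <= i%:R * h by rewrite mulr_ge0.
have := @quadrature_error R h h0 n N nN a1 (- (a2 * (i%:R * h)))
  (fun s => f (i%:R * h) s (x s)) (fun j => f (i%:R * h) (j%:R * h) (y j))
  (Ds * h + L * (K * h + Delta)) 0 i (leq0n i).
rewrite mul0r => H; apply: le_trans (H _ _) _.
- exact: volterra_continuous.
- move=> j s /andP[_ ji]; rewrite /cell /= in_itv /= => /andP[js sj].
  have jh0 : 0 <= j%:R * h by rewrite mulr_ge0.
  have sjh : s - j%:R * h <= h by move: sj; rewrite -natr1 mulrDl mul1r; lra.
  have si : s <= i%:R * h by rewrite (le_trans sj) // ler_pM2r // ler_nat.
  apply: le_trans (increment_le nN f_C1 fL (xS (le_trans jh0 js)) (yS j) js _) _.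
    move=> u /andP[ju us]; rewrite /dom_f /= (le_trans jh0 ju) /=.
    exact: le_trans us si.
  apply: lerD; first exact: ler_wpM2l.
  apply: ler_wpM2l => //.
  apply: le_trans (norm_sub_le nN _ (x (j%:R * h)) _) _; apply: lerD => //.
  by apply: le_trans (xK _ _ jh0 js) _; exact: ler_wpM2l.
- apply: ler_wpM2l; last exact: volterra_weight_le.
  by do !(apply: addr_ge0 || apply: mulr_ge0 || done).
Qed.

End Volterra.

Section Fredholm.
Variables (b c C Dt Ds : R) (g : R -> R -> 'rV[R]_n -> 'rV[R]_n).
Hypotheses (b_gt0 : 0 < b) (cb : c <= b).
Hypothesis g_cont : jointly_continuous (dom_g R) S g.
Hypothesis g_bnd : unif_bounded N (dom_g R) S g C.
Hypothesis g_C1 : C1_bounded N (dom_g R) S g Dt Ds.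

Let bN : - b < 0. Proof. by rewrite oppr_lt0. Qed.

Definition fredholm t : 'rV[R]_n :=
  vintegral `[t, +oo[ (fun s => expR (- b * s + c * t) *: g t s (x s)).

Lemma fredholm_continuous a t : 0 <= t <= a ->
  {within `[a, +oo[, continuous (fun s => g t s (x s))}.
Proof.
move=> /andP[t0 ta]; apply: (continuous_slice g_cont) => [s|].
  rewrite /= in_itv /= andbT => as_; have ts := le_trans ta as_.
  by split; [rewrite /dom_g /= t0 | exact/xS/(le_trans t0)].
apply: continuous_subspaceW x_cont => s.
rewrite half_lineE /= in_itv /= andbT => as_.
exact: le_trans (le_trans t0 ta) as_.
Qed.

Lemma fredholm_bound t s : 0 <= t <= s -> N (g t s (x s)) <= C.
Proof.
move=> /andP[t0 ts].
by apply: g_bnd; [rewrite /dom_g /= t0 | exact/xS/(le_trans t0)].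
Qed.

Lemma fredholm_integrable a t q : 0 <= t <= a ->
  vintegrable `[a, +oo[ (fun s => expR (- b * s + q) *: g t s (x s)).
Proof.
move=> ta; apply: (@vintegrable_tail R n N nN (- b) q a C) => //.
  exact: fredholm_continuous.
move=> s as_; apply: fredholm_bound; case/andP: ta => -> ta /=.
exact: le_trans as_.
Qed.

(** As for [volterra_lipschitz]; on the common half-line the larger of the two
    weights is factored out, so that the other one is a damped copy of it. *)
Lemma fredholm_lipschitz t u : 0 <= t -> t <= u ->
  N (fredholm u - fredholm t) <= ((Dt + `|c| * C) / b + C) * (u - t).
Proof.
move=> t0 tu; have u0 := le_trans t0 tu; have d0 : 0 <= u - t by rewrite subr_ge0.
have D00 : dom_g R (0, 0) by rewrite /dom_g /= lexx.
have C0 : 0 <= C by apply: le_trans (g_bnd D00 (xS (lexx 0))); exact: norm_ge0.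
have [Dt0 _] := C1_bounded_ge0 nN g_C1 (xS (lexx 0)) D00.
have mI : measurable (`[u, +oo[%classic : set (measurableTypeR R)).
  exact: measurable_itv.
have tt : 0 <= t <= t by rewrite t0 lexx.
have tu' : 0 <= t <= u by rewrite t0.
have uu : 0 <= u <= u by rewrite u0 lexx.
have iu := fredholm_integrable (c * u) uu.
have itu := fredholm_integrable (c * t) tu'.
have it := fredholm_integrable (c * t) tt.
rewrite norm_subC // /fredholm (vintegral_split it tu) // -addrA -vintegralB //.
rewrite addrC mulrDl.
apply: le_trans (is_norm_triangle nN _ _) _; apply: lerD; last first.
  apply: le_trans (norm_vintegral_le (b := C) nN _ _ _ _ _) _.
  - exact: measurable_itv.
  - apply: vintegrable_seg; apply: continuous_subspaceW (fredholm_continuous tt).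
    exact: subset_itvl.
  - exact: integrable_expw_seg.
  - by move=> s _; exact: expR_ge0.
  - by move=> s; rewrite /= in_itv /= => /andP[ts _]; apply: fredholm_bound; rewrite t0.
  - apply: ler_wpM2l => //; apply: integral_expw_seg_le => // s /andP[ts _].
    by apply: fredholm_exponent_le0 => //; rewrite t0.
have diff s : u <= s -> N (g u s (x s) - g t s (x s)) <= Dt * (u - t).
  move=> us; apply: (C1_lipschitz_fst nN g_C1) => //; first exact/xS/(le_trans u0).
  by move=> v /andP[tv vu]; rewrite /dom_g /= (le_trans t0) //= (le_trans vu).
(* The weight exp (- b s + c v) is largest at v = u if c >= 0, at v = t if not. *)
pose tau := if 0 <= c then u else t.
have tauu : 0 <= tau <= u by rewrite /tau; case: ifP => _; rewrite ?u0 ?t0 ?tu ?lexx.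
pose G s := expR (c * (t - tau)) *: g t s (x s) - expR (c * (u - tau)) *: g u s (x s).
have E : (fun s => expR (- b * s + c * t) *: g t s (x s) -
    expR (- b * s + c * u) *: g u s (x s)) =
    (fun s => expR (- b * s + c * tau) *: G s).
  apply/funext => s; rewrite /G scalerBr !scalerA -!expRD.
  by congr (expR _ *: _ - expR _ *: _); ring.
have iE := vintegrableB mI itu iu; rewrite E in iE *.
apply: le_trans (norm_vintegral_le (b := (Dt + `|c| * C) * (u - t)) nN mI iE _ _ _) _.
- by have [] := integral_expw_tail (c * tau) u bN.
- by move=> s _; exact: expR_ge0.
- move=> s; rewrite /= in_itv /= andbT => us; rewrite /G /tau.
  have gb v : 0 <= v -> v <= u -> N (g v s (x s)) <= C.
    by move=> v0 vu; apply: fredholm_bound; rewrite v0 (le_trans vu).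
  case: ifP => [c0|/negbT]; last rewrite -ltNge => c0.
    rewrite subrr mulr0 expR0 scale1r -(opprB u t) mulrN.
    apply: le_trans (damped_diff_le nN _ _ _) _; first exact: mulr_ge0.
    rewrite mulrDl norm_subC //; apply: lerD; first exact: diff.
    rewrite ger0_norm // [leRHS]mulrAC; apply: ler_wpM2l; first exact: mulr_ge0.
    exact: gb.
  rewrite subrr mulr0 expR0 scale1r norm_subC // -[c in expR (c * _)]opprK mulNr.
  apply: le_trans (damped_diff_le nN _ _ _) _.
    by rewrite mulr_ge0 // oppr_ge0 ltW.
  rewrite mulrDl; apply: lerD; first exact: diff.
  rewrite ltr0_norm // [leRHS]mulrAC; apply: ler_wpM2l; last exact: gb.
  by rewrite mulr_ge0 // oppr_ge0 ltW.
- rewrite [leRHS]mulrAC; apply: ler_wpM2l; last exact: fredholm_weight_le.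
  by rewrite mulr_ge0 // addr_ge0 // mulr_ge0.
Qed.

Lemma fredholm_quadrature K L Delta h i (y : nat -> 'rV[R]_n) :
  0 < h -> 0 <= K -> 0 <= L -> unif_lipschitz N (dom_g R) S g L ->
  (forall t u, 0 <= t -> t <= u -> N (x u - x t) <= K * (u - t)) ->
  (forall j, S (y j)) -> (forall j : nat, N (x (j%:R * h) - y j) <= Delta) ->
  N (fredholm (i%:R * h) - limn (fun m => \sum_(i <= j < m)
       weight_g b c h i j *: g (i%:R * h) (j%:R * h) (y j)))
  <= (Ds * h + L * (K * h + Delta)) / b.
Proof.
move=> h0 K0 L0 gL xK yS yD.
have h0' := ltW h0.
have D00 : dom_g R (0, 0) by rewrite /dom_g /= lexx.
have [_ Ds0] := C1_bounded_ge0 nN g_C1 (xS (lexx 0)) D00.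
have Delta0 : 0 <= Delta := le_trans (norm_ge0 nN _) (yD 0%N).
have ih0 : 0 <= i%:R * h by rewrite mulr_ge0.
have ihih : 0 <= i%:R * h <= i%:R * h by rewrite ih0 lexx.
have ij_h j : (i <= j)%N -> i%:R * h <= j%:R * h.
  by move=> ij; rewrite ler_pM2r // ler_nat.
have B0 : 0 <= Ds * h + L * (K * h + Delta).
  by do !(apply: addr_ge0 || apply: mulr_ge0 || done).
apply: le_trans (@quadrature_error_tail R h h0 n N nN (- b) (c * (i%:R * h))
  (fun s => g (i%:R * h) s (x s)) (fun j => g (i%:R * h) (j%:R * h) (y j))
  (Ds * h + L * (K * h + Delta)) C i bN B0 _ _ _ _) _.
- exact: fredholm_continuous.
- by move=> s is_; apply: fredholm_bound; rewrite ih0.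
- by move=> j ij; apply: g_bnd => //; rewrite /dom_g /= ih0 ij_h.
- move=> j s ij; rewrite /cell /= in_itv /= => /andP[js sj].
  have jh0 : 0 <= j%:R * h by rewrite mulr_ge0.
  have sjh : s - j%:R * h <= h by move: sj; rewrite -natr1 mulrDl mul1r; lra.
  apply: le_trans (increment_le nN g_C1 gL (xS (le_trans jh0 js)) (yS j) js _) _.
    move=> u /andP[ju us]; rewrite /dom_g /= ih0 /=.
    exact: le_trans (ij_h _ ij) ju.
  apply: lerD; first exact: ler_wpM2l.
  apply: ler_wpM2l => //.
  apply: le_trans (norm_sub_le nN _ (x (j%:R * h)) _) _; apply: lerD => //.
  by apply: le_trans (xK _ _ jh0 js) _; exact: ler_wpM2l.
- by apply: ler_wpM2l => //; exact: fredholm_weight_le.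
Qed.

End Fredholm.
End SolutionLipschitz.

(** * Convergence of the discretization *)

Lemma path_lipschitz (R : realType) (n : nat) (N : 'rV[R]_n -> R)
    (x0 : R -> 'rV[R]_n) : is_norm N -> C1_bounded_path N x0 ->
  exists2 M, 0 <= M &
    forall t u, 0 <= t -> t <= u -> N (x0 u - x0 t) <= M * (u - t).
Proof.
move=> nN [_ [d [dx0 [M dM]]]].
have H0 : half_line R 0 by rewrite half_lineE.
exists M => [|t u t0 tu]; first exact: le_trans (norm_ge0 nN _) (dM 0 H0).
have tuH s : `[t, u]%classic s -> half_line R s.
  by rewrite half_lineE /= in_itv /= => /andP[ts _]; exact: le_trans ts.
apply: (mean_value_inequality nN (A := half_line R) (d := d)) => //.
  by move=> s /tuH; exact: dx0.
by move=> s /tuH; exact: dM.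
Qed.

Lemma disc_error_bigO (R : realType) (n : nat) (N : 'rV[R]_n -> R)
    (x : R -> 'rV[R]_n) (y : R -> nat -> 'rV[R]_n) A :
  is_norm N -> 0 <= A ->
  (forall h (i : nat), 0 < h -> N (x (i%:R * h) - y h i) <= A * h) ->
  disc_error N x y =O_ (0^'+) (@id R).
Proof.
move=> nN A0 eA; apply/eqO_exP.
(* The constant must be positive, while A may be 0. *)
exists (A + 1); first by rewrite ltr_wpDl.
near=> h; have h0 : 0 < h by near: h; exact: nbhs_right_gt.
have ub : ubound [set N (x (i%:R * h) - y h i) | i in [set: nat]] (A * h).
  by move=> _ [i _ <-]; exact: eA.
have ne : [set N (x (i%:R * h) - y h i) | i in [set: nat]] !=set0.
  by exists (N (x (0%:R * h) - y h 0%N)), 0%N.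
have d0 : 0 <= disc_error N x y h.
  apply: le_trans (norm_ge0 nN (x (0%:R * h) - y h 0%N)) _.
  by apply: ub_le_sup; [exists (A * h) | exists 0%N].
rewrite ger0_norm // gtr0_norm //.
apply: le_trans (ge_sup ne ub) _.
by rewrite ler_wpM2r ?lerDl // ltW.
Unshelve. all: by end_near. Qed.

Theorem theorem2p2 (R : realType) (n : nat) (N : 'rV[R]_n -> R)
  (alpha1 alpha2 beta gamma Lf Lg Cf Cg Df Ef Dg Eg : R)
  (x0 : R -> 'rV[R]_n) (f g : R -> R -> 'rV[R]_n -> 'rV[R]_n)
  (S : set 'rV[R]_n) (x : R -> 'rV[R]_n) (xd : R -> nat -> 'rV[R]_n) :
  is_norm N ->
  alpha1 != 0 -> 0 <= alpha2 -> alpha1 <= alpha2 -> 0 < beta -> gamma <= beta ->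
  unif_lipschitz N (dom_f R) S f Lf ->
  unif_lipschitz N (dom_g R) S g Lg ->
  Lf / `|alpha1| + Lg / beta < 1 ->
  jointly_continuous (dom_f R) S f ->
  jointly_continuous (dom_g R) S g ->
  unif_bounded N (dom_f R) S f Cf ->
  unif_bounded N (dom_g R) S g Cg ->
  S = state_set N x0 alpha1 beta Cf Cg ->
  C1_bounded N (dom_f R) S f Df Ef ->
  C1_bounded N (dom_g R) S g Dg Eg ->
  C1_bounded_path N x0 ->
  integral_solution S alpha1 alpha2 beta gamma x0 f g x ->
  (forall h : R, 0 < h ->
     discrete_solution S alpha1 alpha2 beta gamma x0 f g h (x 0) (xd h)) ->
  disc_error N x xd =O_ (0^'+) (@id R).
Proof.
move=> nN a1_neq0 a2_ge0 a12 b_gt0 cb fL gL q_lt1 f_cont g_cont f_bnd g_bnd.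
move=> S_def f_C1 g_C1 x0_C1 [x_cont [xS' x_eq]] xd_sol.
have xS t : 0 <= t -> S (x t) by rewrite -half_lineE; exact: xS'.
have yS h j : 0 < h -> S (xd h j) by move=> /xd_sol[_ []].
have Df00 : dom_f R (0, 0) by rewrite /dom_f /= lexx.
have Dg00 : dom_g R (0, 0) by rewrite /dom_g /= lexx.
have degenerate : (forall y z, S y -> S z -> N (y - z) = 0) ->
    disc_error N x xd =O_ (0^'+) (@id R).
  move=> S0; apply: (@disc_error_bigO _ _ _ _ _ 0) => // h i h0.
  rewrite mul0r S0 //; last exact: yS.
  by apply: xS; rewrite mulr_ge0 // ltW.
(* A negative Lipschitz constant collapses [S] to a point. *)
have [Lf_ge0|Lf_lt0] := leP 0 Lf; last first.
  by apply: degenerate => y z; exact: (lipschitz_lt0 nN fL Df00 Lf_lt0).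
have [Lg_ge0|Lg_lt0] := leP 0 Lg; last first.
  by apply: degenerate => y z; exact: (lipschitz_lt0 nN gL Dg00 Lg_lt0).
have [M M0 x0M] := path_lipschitz nN x0_C1.
have S0 := xS 0 (lexx 0).
have [Df0 Ef0] := C1_bounded_ge0 nN f_C1 S0 Df00.
have [Dg0 Eg0] := C1_bounded_ge0 nN g_C1 S0 Dg00.
have Cf0 : 0 <= Cf := le_trans (norm_ge0 nN _) (f_bnd _ _ _ Df00 S0).
have Cg0 : 0 <= Cg := le_trans (norm_ge0 nN _) (g_bnd _ _ _ Dg00 S0).
have b0 := ltW b_gt0.
pose K := M + ((Df + alpha2 * Cf) / `|alpha1| + Cf) +
  ((Dg + `|gamma| * Cg) / beta + Cg).
have K0 : 0 <= K.
  by rewrite /K; do !(apply: addr_ge0 || apply: mulr_ge0 || rewrite invr_ge0 || done).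
have x_split t : 0 <= t ->
    x t = x0 t + volterra x alpha1 alpha2 f t + fredholm x beta gamma g t.
  by move=> t0; apply: x_eq; rewrite half_lineE.
have xK t u : 0 <= t -> t <= u -> N (x u - x t) <= K * (u - t).
  move=> t0 tu; rewrite !x_split // ?(le_trans t0) //.
  rewrite opprD addrACA [in X in N (X + _)]opprD [in X in N (X + _)]addrACA.
  rewrite /K !(mulrDl _ _ (u - t)).
  apply: le_trans (is_norm_triangle nN _ _) _; apply: lerD.
    apply: le_trans (is_norm_triangle nN _ _) _; apply: lerD; first exact: x0M.
    rewrite -mulrDl.
    exact: (volterra_lipschitz nN x_cont xS a1_neq0 a2_ge0 a12
              f_cont f_bnd f_C1).
  rewrite -mulrDl; exact: (fredholm_lipschitz nN x_cont xS b_gt0 cb g_cont g_bnd g_C1).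
pose q := Lf / `|alpha1| + Lg / beta.
pose A := ((Ef + Lf * K) / `|alpha1| + (Eg + Lg * K) / beta) / (1 - q).
have q0 : 0 <= q by rewrite /q addr_ge0 // divr_ge0.
have q1 : 0 < 1 - q by rewrite subr_gt0.
have A0 : 0 <= A.
  by rewrite /A divr_ge0 ?(ltW q1) // addr_ge0 // divr_ge0 // addr_ge0 // mulr_ge0.
apply: (disc_error_bigO nN A0) => h i h0.
pose E := [set N (x (j%:R * h) - xd h j) | j in [set: nat]].
have E_sup : has_sup E.
  split; first by exists (N (x (0%:R * h) - xd h 0%N)), 0%N.
  exists (2 * (sup_norm N x0 + Cf / `|alpha1| + Cg / beta)) => _ [j _ <-].
  have Sx : S (x (j%:R * h)) by apply: xS; rewrite mulr_ge0 // ltW.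
  have := yS h j h0; move: Sx; rewrite S_def /state_set /= => Sx Sy.
  have := is_norm_triangle nN (x (j%:R * h)) (- xd h j); rewrite normN //.
  by move: Sx Sy; lra.
have eE j : N (x (j%:R * h) - xd h j) <= sup E.
  by apply: ub_le_sup; [exact: E_sup.2 | exists j].
apply: le_trans (eE i) _.
have sup_le : sup E <= A * (1 - q) * h + q * sup E.
  have supE0 : 0 <= sup E := le_trans (norm_ge0 nN _) (eE 0%N).
  have [y0 [_ y_eq]] := xd_sol h h0.
  apply: ge_sup; first exact: E_sup.1.
  (* Node 0 is exact. *)
  move=> _ [[|i'] _ <-].
    rewrite mul0r y0 subrr norm0 //.
    by have := ltW h0; have := ltW q1 => ? ?; apply: addr_ge0; do !(done || apply: mulr_ge0).
  set j := i'.+1.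
  rewrite x_split ?mulr_ge0 ?(ltW h0) // y_eq // opprD addrACA.
  rewrite [in X in N (X + _)]opprD [in X in N (X + _)]addrACA subrr add0r.
  apply: le_trans (is_norm_triangle nN _ _) _.
  have yS' k := yS h k h0.
  have hV := volterra_quadrature nN x_cont xS a1_neq0 a2_ge0 a12 f_cont f_C1
    j h0 K0 Lf_ge0 fL xK yS' eE.
  have hF := fredholm_quadrature nN x_cont xS b_gt0 cb g_cont g_bnd g_C1
    j h0 K0 Lg_ge0 gL xK yS' eE.
  apply: le_trans (lerD hV hF) _.
  rewrite /A divfK ?gt_eqF // /q.
  rewrite le_eqVlt; apply/orP; left; apply/eqP; ring.
by rewrite -(ler_pM2r q1); move: sup_le; lra.
Qed.
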